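(* Let $\mathcal H$ be a complex Hilbert space, $(\Sigma,\mathcal M,\mu)$ a measure space and $\pi\in\mathrm{SQ}(\mathbb B(\mathcal H),\mu)$. For every trace-class operator $T\in\mathbb B_1(\mathcal H)\subset\mathbb B_2(\mathcal H)$ one has $$[\Pi^{-1}(T)](s)=\mathrm{Tr}[T\pi(s)]\qquad\text{for }\mu\text{-a.e. }s\in\Sigma.$$
   Context: Inner products are linear in the first variable and antilinear in the second. $\mathrm{SQ}(\mathbb B(\mathcal H),\mu)$ denotes the set of all almost everywhere defined, weakly measurable maps $\pi:\Sigma\to\mathbb B(\mathcal H)$ such that $\int_\Sigma\langle\pi(s)u_1,v_1\rangle\langle v_2,\pi(s)u_2\rangle\,d\mu(s)=\langle u_1,u_2\rangle\langle v_2,v_1\rangle$ for all $u_1,u_2,v_1,v_2\in\mathcal H$. Let $\overline{\mathcal H}$ be the conjugate Hilbert space, $\widehat\otimes$ the Hilbert space tensor product, and $\mathbb B_2(\mathcal H)$ the Hilbert–Schmidt operators with $\langle S,T\rangle=\mathrm{Tr}(ST^* )$. $\Lambda:\mathcal H\widehat\otimes\overline{\mathcal H}\to\mathbb B_2(\mathcal H)$ is the unitary operator with $\Lambda(u\otimes v)=\langle\cdot,v\rangle u$; $\Phi:\mathcal H\widehat\otimes\overline{\mathcal H}\to L^2(\Sigma;\mu)$ is the linear isometry with $\Phi(u\otimes v)=\langle\pi(\cdot)u,v\rangle$; $\mathscr B_2(\Sigma):=\mathrm{Ran}\,\Phi\subseteq L^2(\Sigma;\mu)$; and $\Pi:=\Lambda\circ\Phi^{-1}:\mathscr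 B_2(\Sigma)\to\mathbb B_2(\mathcal H)$ is unitary. *)

(* Defs.v *)
From HB Require Import structures.
From mathcomp Require Import all_boot all_order all_algebra.
From mathcomp Require Import complex.
From mathcomp Require Import all_classical all_reals all_analysis.

Set Implicit Arguments.
Unset Strict Implicit.
Unset Printing Implicit Defensive.
Import Order.TTheory GRing.Theory Num.Theory.
Import numFieldNormedType.Exports.
Local Open Scope classical_set_scope.
Local Open Scope ring_scope.
Local Open Scope complex_scope.

(* The inner product is linear in the first variable. *)
HB.mixin Record CompleteNormedModule_isHilbert (R : realType) H
    & CompleteNormedModule R[i] H := {
  inner : H -> H -> R[i];
  inner_linearl : forall y, linear_for *%R (inner ^~ y);
  inner_conj : forall x y, inner y x = (inner x y)^*;
  inner_norm : forall x, inner x x = `|x| ^+ 2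
}.

#[short(type="hilbertType")]
HB.structure Definition Hilbert (R : realType) :=
  {H of CompleteNormedModule R[i] H & CompleteNormedModule_isHilbert R H}.

(* The conjugate Hilbert space: same vectors, sums and norm, scalars acting
   through their conjugates. *)
Definition conjugate (H : Type) : Type := H.

Section conjugate_hilbert.
Variables (R : realType) (H : hilbertType R).

HB.instance Definition _ := Complete.copy (conjugate H) H.
HB.instance Definition _ := PseudoMetricNormedZmod.copy (conjugate H) H.

Definition conjugate_scale (a : R[i]) (x : conjugate H) : conjugate H :=
  (a^* *: (x : H)).

Fact conjugate_scaleA a b x :
  conjugate_scale a (conjugate_scale b x) = conjugate_scale (a * b) x.
Proof. by rewrite /conjugate_scale scalerA rmorphM. Qed.

Fact conjugate_scale1 : left_id 1 conjugate_scale.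
Proof. by move=> x; rewrite /conjugate_scale rmorph1 scale1r. Qed.

Fact conjugate_scaleDr : right_distributive conjugate_scale +%R.
Proof. by move=> a x y; exact: (@scalerDr _ H). Qed.

Fact conjugate_scaleDl x : {morph conjugate_scale^~ x : a b / a + b}.
Proof. by move=> a b; rewrite /conjugate_scale rmorphD; exact: (@scalerDl _ H). Qed.

HB.instance Definition _ := GRing.Zmodule_isLmodule.Build R[i] (conjugate H)
  conjugate_scaleA conjugate_scale1 conjugate_scaleDr conjugate_scaleDl.

Fact conjugate_normrZ (a : R[i]) (x : conjugate H) : `|a *: x| = `|a| * `|x|.
Proof.
by rewrite -(normcJ a); exact: (@normrZ _ H).
Qed.

HB.instance Definition _ :=
  PseudoMetricNormedZmod_Lmodule_isNormedModule.Build R[i] (conjugate H)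
    conjugate_normrZ.

Definition conjugate_inner (x y : conjugate H) : R[i] := inner (y : H) (x : H).

Fact conjugate_inner_linearl y : linear_for *%R (conjugate_inner ^~ y).
Proof.
move=> a u v; rewrite /conjugate_inner (@inner_conj _ H) (inner_linearl y).
by rewrite rmorphD rmorphM /= conjcK -!(@inner_conj _ H).
Qed.

Fact conjugate_inner_conj x y : conjugate_inner y x = (conjugate_inner x y)^*.
Proof. exact: inner_conj. Qed.

Fact conjugate_inner_norm x : conjugate_inner x x = `|x| ^+ 2.
Proof. exact: inner_norm. Qed.

HB.instance Definition _ :=
  CompleteNormedModule_isHilbert.Build R (conjugate H)
    conjugate_inner_linearl conjugate_inner_conj conjugate_inner_norm.

End conjugate_hilbert.

(* (W, tens) is a Hilbert space tensor product of H and K; this determines it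
   up to a unique unitary compatible with tens. *)
Definition hilbert_tensor (R : realType) (H K W : hilbertType R)
    (tens : H -> K -> W) :=
  [/\ forall v, linear (tens ^~ v),
      forall u, linear (tens u),
      forall u v u' v',
        inner (tens u v) (tens u' v') = inner u u' * inner v v' &
      closure [set w | exists n (u : 'I_n -> H) (v : 'I_n -> K),
                 w = \sum_(i < n) tens (u i) (v i)] = setT].

Section operators.
Variables (R : realType) (H : hilbertType R).
Implicit Types (A S T : H -> H) (E : set H).

Definition bounded_op : set (H -> H) := [set T | linear T /\ continuous T].

(* For bounded T the vector z exists (Riesz) and is unique. *)
Definition adj T : H -> H :=
  fun y => xget 0 [set z | forall x, inner (T x) y = inner x z].

Definition orthonormal_basis E :=
  (forall e f, E e -> E f -> inner e f = (e == f)%:R) /\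
  (forall x, (forall e, E e -> inner x e = 0) -> x = 0).

(* Unordered sum: H need not be separable. *)
Definition has_sum (I : choiceType) (D : set I) (f : I -> R[i]) (z : R[i]) :=
  forall eps : R, 0 < eps -> exists2 F, fsets D F &
    forall G, fsets D G -> F `<=` G -> `|\sum_(i \in G) f i - z| < eps%:C.

(* Tr T = z, the trace converging in every orthonormal basis. *)
Definition has_trace T (z : R[i]) :=
  forall E, orthonormal_basis E -> has_sum E (fun e => inner (T e) e) z.

Definition hilbert_schmidt : set (H -> H) :=
  [set T | bounded_op T /\
     exists2 E, orthonormal_basis E &
       (\esum_(e in E) (complex.Re (`|T e| ^+ 2))%:E < +oo)%E].

(* A = |T|, the positive square root of T^* T. *)
Definition is_abs T A :=
  [/\ bounded_op A, forall x, 0 <= inner (A x) x & A \o A = adj T \o T].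

Definition trace_class : set (H -> H) :=
  [set T | bounded_op T /\
     exists2 A, is_abs T A &
       exists2 E, orthonormal_basis E &
         (\esum_(e in E) (complex.Re (inner (A e) e))%:E < +oo)%E].

Lemma orthonormal_basis_exists : exists E, orthonormal_basis E.
Proof.
pose P : set (set H) := [set E | forall e f, E e -> E f ->
  inner e f = (e == f)%:R].
have [F FP Ftot|E [PE Emax]] := @Zorn_bigcup _ P.
  move=> e f [A FA Ae] [B FB Bf].
  have [AB|BA] := Ftot A B FA FB; first exact: (FP B FB _ _ (AB _ Ae) Bf).
  exact: (FP A FA _ _ Ae (BA _ Bf)).
exists E; split => // x xE; apply: contrapT => x0.
have nx0 : `|x| != 0 by rewrite normr_eq0; exact/eqP.
pose y := `|x|^-1 *: x.
have innerZl a (u v : H) : inner (a *: u) v = a * inner u v.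
  have := inner_linearl v a u 0; rewrite addr0 => ->.
  have := inner_linearl v 1 0 0; rewrite scaler0 addr0 mul1r => h.
  by have/eqP := h; rewrite -subr_eq0 opprD addrA subrr add0r oppr_eq0 => /eqP ->;
    rewrite addr0.
have innery e : E e -> inner y e = 0.
  by move=> Ee; rewrite innerZl xE// mulr0.
have inneryy : inner y y = 1.
  by rewrite inner_norm normrZ normfV normr_id mulVf// expr1n.
have Ey : ~ E y by move=> /[dup] /innery; rewrite inneryy => /eqP; rewrite oner_eq0.
apply: (Emax (y |` E)).
  split; first by move=> e Ee; right.
  by move=> /(_ y (or_introl erefl)).
move=> e f [->|Ee] [->|Ef].
- by rewrite inneryy eqxx.
- by rewrite innery//; case: eqP => // yf; case: Ey; rewrite yf.
- rewrite inner_conj innery// rmorph0; case: eqP => // ey.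
  by case: Ey; rewrite -ey.
- exact: PE.
Qed.

End operators.

Section quantization.
Context d (X : measurableType d) (R : realType).
Variables (mu : {measure set X -> \bar R}) (H : hilbertType R).

Definition cmeasurable (D : set X) (f : X -> R[i]) :=
  measurable_fun D (fun s => complex.Re (f s)) /\ measurable_fun D (fun s => complex.Im (f s)).

Definition has_cintegral (D : set X) (f : X -> R[i]) (z : R[i]) :=
  [/\ mu.-integrable D (fun s => (complex.Re (f s))%:E),
      mu.-integrable D (fun s => (complex.Im (f s))%:E) &
      z = (\int[mu]_(s in D) complex.Re (f s)) +i* (\int[mu]_(s in D) complex.Im (f s))].

(* The almost everywhere defined map is the restriction of pi to the conull
   set D; the values of pi off D are irrelevant. *)
Definition SQ (D : set X) (pi : X -> H -> H) :=
  [/\ measurable D /\ mu (~` D) = 0%E,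
      forall s, D s -> bounded_op (pi s),
      forall u v, cmeasurable D (fun s => inner (pi s u) v) &
      forall u1 u2 v1 v2,
        has_cintegral D (fun s => inner (pi s u1) v1 * inner v2 (pi s u2))
          (inner u1 u2 * inner v2 v1)].

(* Elements of L^2(X; mu) are given by representatives: every equality between
   them is stated as an equality almost everywhere. *)
Definition L2norm2 (f : X -> R[i]) : \bar R :=
  (\int[mu]_s (complex.Re (`|f s| ^+ 2))%:E)%E.

Definition L2 : set (X -> R[i]) :=
  [set f | cmeasurable setT f /\ (L2norm2 f < +oo)%E].

Variables (W : hilbertType R) (tens : H -> conjugate H -> W).

(* Lambda is a unitary operator onto the Hilbert-Schmidt operators for the inner
   product <S, T> = Tr (S T^* ), with Lambda (u (x) v) = <., v> u. *)
Definition is_Lambda (Lambda : W -> H -> H) :=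
  [/\ forall a w w' x, Lambda (a *: w + w') x = a *: Lambda w x + Lambda w' x,
      range Lambda = @hilbert_schmidt R H,
      forall w w', has_trace (Lambda w \o adj (Lambda w')) (inner w w') &
      forall u v : H, Lambda (tens u v) = fun x => inner x v *: u].

(* Phi is a linear isometry into L^2 with Phi (u (x) v) = <pi(.) u, v>. *)
Definition is_Phi (D : set X) (pi : X -> H -> H) (Phi : W -> X -> R[i]) :=
  [/\ forall w, L2 (Phi w),
      forall a w w',
        Phi (a *: w + w') = (fun s => a * Phi w s + Phi w' s) %[ae mu],
      forall w, L2norm2 (Phi w) = (complex.Re (`|w| ^+ 2))%:E &
      forall u v : H, Phi (tens u v) = (fun s => inner (pi s u) v) %[ae mu in D]].

Variables (Lambda : W -> H -> H) (Phi : W -> X -> R[i]).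

(* The range of Phi. *)
Definition B2Sigma : set (X -> R[i]) :=
  [set f | L2 f /\ exists w, f = Phi w %[ae mu]].

Definition Phi_inv (f : X -> R[i]) : W := xget 0 [set w | f = Phi w %[ae mu]].

Definition Pi (f : X -> R[i]) : H -> H := Lambda (Phi_inv f).

(* Any representative: Pi is injective up to equality a.e. *)
Definition Pi_inv (T : H -> H) : X -> R[i] :=
  xget (cst 0) [set f | B2Sigma f /\ Pi f = T].

End quantization.

(* Main.v *)
Require Import Defs.
From mathcomp Require Import all_boot all_order all_algebra.
From mathcomp Require Import complex.
From mathcomp Require Import all_classical all_reals all_analysis.
From mathcomp Require Import measurable_realfun finmap ring lra.
Set Implicit Arguments.
Unset Strict Implicit.
Unset Printing Implicit Defensive.
Import Order.TTheory GRing.Theory Num.Theory.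
Import numFieldNormedType.Exports.
Local Open Scope classical_set_scope.
Local Open Scope ring_scope.
Local Open Scope complex_scope.
Local Notation "a ^*" := (conjc a) : ring_scope.

(** The trace class operator T is written as a nuclear series
    T = sum_k <., v_k> u_k with sum_k |u_k| |v_k| finite.  Then
    w = sum_k u_k (x) v_k converges absolutely in the tensor product,
    Lambda w = T, and Pi^-1 T = Phi w almost everywhere because Phi and Lambda
    are injective.  Both sides of the theorem are then the same scalar series
    sum_k <pi(s) u_k, v_k>:
    - Phi w is its limit in L^2; at every s of the domain of pi the series
      also converges absolutely, pi(s) being bounded, and an L^2 limit and a
      pointwise limit agree almost everywhere ([Phi_series]);
    - T pi(s) = sum_k <., pi(s)^* v_k> u_k is again nuclear, and the trace of
      a nuclear operator, in any orthonormal basis, is the sum of the traces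
      <u_k, pi(s)^* v_k> = <pi(s) u_k, v_k> of its terms ([nuclear_trace]).

    The nuclear series comes from neither the spectral theorem nor the polar
    decomposition, but from a Cholesky factorization of A = |T|: Gram-Schmidt
    for the semi-definite form <Ax, y>, applied to a sequence of vectors that
    contains those e of an orthonormal basis with <Ae, e> <> 0, which are
    countably many, gives vectors f_k with
    A = sum_k <., A f_k> A f_k.  Bessel's inequality for that form bounds
    sum_k |A f_k|^2 by the trace of A.  As |Tx| = |Ax|, the vectors
    u_k = T f_k and v_k = A f_k have equal norms, and the identity
    T = sum_k <., v_k> u_k follows from that for A ([trace_class_nuclear]).

    That Lambda w = T is read off the matrix entries: being isometric for the
    trace inner product, Lambda satisfies
    <Lambda w x, y> = <w, y (x) x> ([inner_Lambda]).  The supporting facts on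
    Hilbert spaces that need not be separable (Parseval, density of finite
    combinations of a basis, Riesz representation, adjoints) all come from one
    Riesz-Fischer argument ([riesz_fischer]). *)

(** * Real-valued norms and the inner product *)

Section real_norm.
Variables (R : realType) (V : normedZmodType R[i]).
Implicit Types x y : V.

(** The norm takes values in [R[i]], which is only partially ordered; its real
    part carries the same information in [R], where suprema and linear
    arithmetic are available. *)
Definition rnorm (x : V) : R := complex.Re `|x|.

Lemma rnormE x : `|x| = (rnorm x)%:C.
Proof. by rewrite /rnorm RRe_real// ger0_real. Qed.

Lemma rnorm_ge0 x : 0 <= rnorm x.
Proof. by rewrite -ler0c -rnormE. Qed.

Lemma rnorm0 : rnorm (0 : V) = 0.
Proof. by rewrite /rnorm normr0. Qed.

Lemma rnorm0_eq0 x : rnorm x = 0 -> x = 0.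
Proof. by move=> x0; apply/normr0_eq0; rewrite rnormE x0. Qed.

Lemma rnormN x : rnorm (- x) = rnorm x.
Proof. by rewrite /rnorm normrN. Qed.

Lemma rnormB x y : rnorm (x - y) = rnorm (y - x).
Proof. by rewrite /rnorm distrC. Qed.

Lemma rnormD x y : rnorm (x + y) <= rnorm x + rnorm y.
Proof. by rewrite -lecR rmorphD/= -!rnormE ler_normD. Qed.

Lemma rnorm_sum (I : Type) (r : seq I) (P : pred I) (F : I -> V) :
  rnorm (\sum_(i <- r | P i) F i) <= \sum_(i <- r | P i) rnorm (F i).
Proof.
elim/big_rec2: _ => [|i y1 y2 _ h]; first by rewrite rnorm0.
by rewrite (le_trans (rnormD _ _))// lerD2l.
Qed.

End real_norm.

Lemma rnorm_conj (R : realType) (a : R[i]) : rnorm a^* = rnorm a.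
Proof. by rewrite /rnorm normcJ. Qed.

Lemma rnorm_sqr (R : realType) (a : R[i]) : (rnorm a ^+ 2)%:C = a * a^*.
Proof. by rewrite rmorphXn/= -rnormE; exact: normCK. Qed.

Lemma rnorm_real (R : realType) (a : R) : rnorm a%:C = `|a|.
Proof. by rewrite /rnorm normc_def /= expr0n addr0 sqrtr_sqr. Qed.

Section hilbert_inner.
Variables (R : realType) (H : hilbertType R).
Implicit Types (x y z : H) (a b : R[i]).

Lemma inner0l y : inner (0 : H) y = 0.
Proof.
have := inner_linearl y 1 0 0; rewrite scaler0 addr0 mul1r => /eqP.
by rewrite -{1}[inner 0 y]addr0 (inj_eq (addrI _)) eq_sym => /eqP.
Qed.

Lemma innerZl a x y : inner (a *: x) y = a * inner x y.
Proof. by have := inner_linearl y a x 0; rewrite !addr0 inner0l addr0. Qed.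

Lemma innerDl x y z : inner (x + y) z = inner x z + inner y z.
Proof. by have := inner_linearl z 1 x y; rewrite scale1r mul1r. Qed.

Lemma innerBl x y z : inner (x - y) z = inner x z - inner y z.
Proof. by rewrite innerDl -scaleN1r innerZl mulN1r. Qed.

Lemma inner0r x : inner x (0 : H) = 0.
Proof. by rewrite inner_conj inner0l rmorph0. Qed.

Lemma innerZr a x y : inner x (a *: y) = a^* * inner x y.
Proof. by rewrite inner_conj innerZl rmorphM/= -inner_conj. Qed.

Lemma innerDr x y z : inner x (y + z) = inner x y + inner x z.
Proof. by rewrite inner_conj innerDl rmorphD/= -!inner_conj. Qed.

Lemma innerBr x y z : inner x (y - z) = inner x y - inner x z.
Proof. by rewrite inner_conj innerBl rmorphB/= -!inner_conj. Qed.

Lemma inner_suml I (r : seq I) P (F : I -> H) y :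
  inner (\sum_(i <- r | P i) F i) y = \sum_(i <- r | P i) inner (F i) y.
Proof. by apply: (big_morph (inner^~ y)) => [u v|]; rewrite ?innerDl ?inner0l. Qed.

Lemma inner_sumr I (r : seq I) P (F : I -> H) y :
  inner y (\sum_(i <- r | P i) F i) = \sum_(i <- r | P i) inner y (F i).
Proof. by apply: (big_morph (inner y)) => [u v|]; rewrite ?innerDr ?inner0r. Qed.

Lemma innerE x : inner x x = (rnorm x ^+ 2)%:C.
Proof. by rewrite inner_norm rnormE rmorphXn. Qed.

Lemma inner_eq0 x : inner x x = 0 -> x = 0.
Proof.
by rewrite innerE => /complexI/eqP; rewrite expf_eq0/= => /eqP/rnorm0_eq0.
Qed.

Lemma inner_inj x x' : (forall y, inner x y = inner x' y) -> x = x'.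
Proof.
by move=> h; apply/eqP; rewrite -subr_eq0; apply/eqP/inner_eq0;
  rewrite innerBl h subrr.
Qed.

Lemma rnormZ a x : rnorm (a *: x) = rnorm a * rnorm x.
Proof. by apply: complexI; rewrite rmorphM/= -!rnormE normrZ. Qed.

Lemma cauchy_schwarz x y : rnorm (inner x y) <= rnorm x * rnorm y.
Proof.
have [y0|y0] := eqVneq (rnorm y) 0.
  by rewrite y0 (rnorm0_eq0 y0) inner0r rnorm0 mulr0.
have y2 : 0 < rnorm y ^+ 2 by rewrite exprn_gt0// lt_neqAle eq_sym y0 rnorm_ge0.
(* z is orthogonal to y, scaled so that no division occurs. *)
pose z := (rnorm y ^+ 2)%:C *: x - inner x y *: y.
have : inner z z =
    (rnorm y ^+ 2 * (rnorm y ^+ 2 * rnorm x ^+ 2 - rnorm (inner x y) ^+ 2))%:C.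
  rewrite /z !(innerBl, innerBr, innerZl, innerZr) !innerE !conjc_real.
  rewrite (inner_conj x y) [RHS]rmorphM [X in _ = _ * X]rmorphB /=.
  by rewrite (rnorm_sqr (inner x y)); ring.
rewrite innerE => /complexI h.
have : 0 <= rnorm y ^+ 2 * (rnorm y ^+ 2 * rnorm x ^+ 2 - rnorm (inner x y) ^+ 2).
  by rewrite -h sqr_ge0.
rewrite pmulr_rge0// subr_ge0 mulrC -exprMn ler_pXn2r ?nnegrE//.
- exact: rnorm_ge0.
- by rewrite mulr_ge0 ?rnorm_ge0.
Qed.

End hilbert_inner.

(** * Norm convergence of sequences and series *)

Lemma sum_ord_cat (V : zmodType) (F : nat -> V) N n : (N <= n)%N ->
  \sum_(k < n) F k - \sum_(k < N) F k = \sum_(N <= k < n) F k.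
Proof.
move=> Nn; rewrite -!(big_mkord xpredT) (big_cat_nat (leq0n N) Nn)/=.
by rewrite addrAC subrr add0r.
Qed.

Lemma sum_subset_le (R : realType) (I : eqType) (s s' : seq I) (f : I -> R) :
  (forall e, 0 <= f e) -> uniq s -> uniq s' -> {subset s' <= s} ->
  \sum_(e <- s') f e <= \sum_(e <- s) f e.
Proof.
move=> f0 us us' ss'.
have -> : \sum_(e <- s') f e = \sum_(e <- s | e \in s') f e.
  rewrite -[RHS]big_filter; apply: perm_big; apply: uniq_perm => //.
    exact: filter_uniq.
  by move=> e; rewrite mem_filter; case: (boolP (e \in s')) => // /ss' ->.
rewrite big_mkcond; apply: ler_sum => e _; case: ifP => // _.
Qed.

Section limits.
Variable R : realType.

(** Convergence in norm through the real-valued norm, so that estimates stay in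
    [R]; it serves vectors and scalars in [R[i]] alike. *)
Definition ncvg (V : normedZmodType R[i]) (s : nat -> V) (l : V) :=
  (fun n => rnorm (l - s n)) @ \oo --> (0 : R).

Lemma ncvgP (V : normedZmodType R[i]) (s : nat -> V) (l : V) :
  ncvg s l <->
  (forall e : R, 0 < e -> exists N, forall n, (N <= n)%N -> rnorm (l - s n) < e).
Proof.
split=> [/cvgrPdist_lt h e /h [N _ hN]|h].
  exists N => n Nn; have := hN n Nn.
  by rewrite /= sub0r normrN ger0_norm ?rnorm_ge0.
apply/cvgrPdist_lt => e /h [N hN]; exists N => // n Nn.
by rewrite /= sub0r normrN ger0_norm ?rnorm_ge0 ?hN.
Qed.

Lemma ncvg_le (V U : normedZmodType R[i]) (s : nat -> V) (l : V)
    (t : nat -> U) (m : U) (C : R) :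
  ncvg s l -> (forall n, rnorm (m - t n) <= C * rnorm (l - s n)) -> ncvg t m.
Proof.
move=> sl h; rewrite /ncvg.
apply: (@squeeze_cvgr _ _ _ _ (cst 0) (fun n => C * rnorm (l - s n))).
- by apply: nearW => n; rewrite rnorm_ge0 h.
- exact: cvg_cst.
- by rewrite -[0](mulr0 C); apply: cvgM => //; exact: cvg_cst.
Qed.

Lemma ncvg_unique (V : normedZmodType R[i]) (s : nat -> V) (l m : V) :
  ncvg s l -> ncvg s m -> l = m.
Proof.
move=> /ncvgP sl /ncvgP sm; apply/eqP; rewrite -subr_eq0; apply/eqP.
apply: rnorm0_eq0; apply/eqP; rewrite eq_le rnorm_ge0 andbT; apply/ler_addgt0Pl => e e0.
have [N hN] := sl _ (divr_gt0 e0 (ltr0n _ 2)).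
have [M hM] := sm _ (divr_gt0 e0 (ltr0n _ 2)).
have h1 := hN (maxn N M) (leq_maxl _ _); have h2 := hM _ (leq_maxr N M).
rewrite addr0 -(subrKA (s (maxn N M))) (le_trans (rnormD _ _))//.
by rewrite [X in _ + X]rnormB [leRHS]splitr lerD// ltW.
Qed.

Lemma ncvg_near_const (V : normedZmodType R[i]) (s : nat -> V) (l : V) N :
  (forall n, (N <= n)%N -> s n = l) -> ncvg s l.
Proof.
move=> h; apply/ncvgP => e e0; exists N => n /h ->.
by rewrite subrr rnorm0.
Qed.

Lemma ncvg_rnorm_le (V : normedZmodType R[i]) (s : nat -> V) (l : V) (C : R) N :
  ncvg s l -> (forall n, (N <= n)%N -> rnorm (s n) <= C) -> rnorm l <= C.
Proof.
move=> /ncvgP sl h; apply/ler_addgt0Pl => e /sl [M hM].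
have h1 := hM _ (leq_maxr N M); have h2 := h _ (leq_maxl N M).
by rewrite -[l](subrK (s (maxn N M))) (le_trans (rnormD _ _))// lerD// ltW.
Qed.

Lemma ncvgB_cst (V : normedZmodType R[i]) (s : nat -> V) (l a : V) :
  ncvg s l -> ncvg (fun n => s n - a) (l - a).
Proof.
by move=> /ncvg_le -/(_ V (fun n => s n - a) (l - a) 1); apply=> n;
  rewrite mul1r opprB subrKA.
Qed.

Lemma ncvg_sum (V : normedZmodType R[i]) (I : Type) (r : seq I)
    (s : I -> nat -> V) (l : I -> V) :
  (forall i, ncvg (s i) (l i)) ->
  ncvg (fun n => \sum_(i <- r) s i n) (\sum_(i <- r) l i).
Proof.
move=> h; elim: r => [|i r IH].
  by apply: (@ncvg_near_const _ _ _ 0%N) => n _; rewrite !big_nil.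
apply/ncvgP => e e0.
have [N hN] := (ncvgP _ _).1 (h i) _ (divr_gt0 e0 (ltr0n _ 2)).
have [M hM] := (ncvgP _ _).1 IH _ (divr_gt0 e0 (ltr0n _ 2)).
exists (maxn N M) => n; rewrite geq_max => /andP[Nn Mn].
rewrite !big_cons opprD addrACA (le_lt_trans (rnormD _ _))//.
by rewrite [ltRHS]splitr ltrD ?hN ?hM.
Qed.

Lemma cauchy_ncvg (V : completeNormedModType R[i]) (s : nat -> V) :
  (forall e : R, 0 < e -> exists N, forall m n, (N <= m)%N -> (N <= n)%N ->
    rnorm (s m - s n) < e) ->
  exists l, ncvg s l.
Proof.
move=> h.
have : cauchy (s @ \oo).
  apply: cauchy_exP => e e0.
  have eE : e = (complex.Re e)%:C by rewrite RRe_real// gtr0_real.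
  have /h [N hN] : 0 < complex.Re e by rewrite -ltcR -eE.
  exists (s N); exists N => // n Nn.
  by rewrite -ball_normE /ball_/= rnormE eE ltcR hN//.
move=> /cauchy_cvgP /cvg_ex[l sl]; exists l.
apply/ncvgP => e e0.
have /cvgrPdist_lt /(_ e%:C) := sl.
rewrite (ltcR 0) => /(_ e0) [N _ hN]; exists N => n /hN /=.
by rewrite rnormE ltcR.
Qed.

Lemma bounded_sum_tail (c : nat -> R) (M : R) : (forall k, 0 <= c k) ->
  (forall n, \sum_(k < n) c k <= M) ->
  forall e : R, 0 < e -> exists N, forall n, (N <= n)%N ->
    \sum_(N <= k < n) c k < e.
Proof.
move=> c0 cM e e0.
pose A := [set \sum_(k < n) c k | n in [set: nat]].
have supA : has_sup A.
  split; first by exists (\sum_(k < 0) c k); exists 0%N.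
  by exists M => _ [n _ <-].
have [_ [N _ <-] hN] := sup_adherent e0 supA.
exists N => n Nn.
have : \sum_(k < n) c k <= sup A by apply: ub_le_sup; [exact: supA.2|exists n].
move: hN; rewrite -!(big_mkord xpredT) (big_cat_nat (leq0n N) Nn)//= => hN h.
by rewrite -(ltrD2l (\sum_(0 <= i < N) c i)) (le_lt_trans h)// -ltrBlDr.
Qed.

Lemma abs_series_ncvg (V : completeNormedModType R[i]) (x : nat -> V) (M : R) :
  (forall n, \sum_(k < n) rnorm (x k) <= M) ->
  exists l, ncvg (fun n => \sum_(k < n) x k) l.
Proof.
move=> xM; apply: cauchy_ncvg => e e0.
have [N hN] := bounded_sum_tail (fun k => rnorm_ge0 (x k)) xM e0.
exists N => m n; wlog mn : m n / (m <= n)%N => [wl Nm Nn|Nm Nn].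
  by have [mn|/ltnW nm] := leqP m n; [|rewrite rnormB]; exact: wl.
rewrite rnormB -!(big_mkord xpredT) (big_cat_nat (leq0n m) mn)//= addrAC subrr add0r.
rewrite (le_lt_trans (rnorm_sum _ _ _))// (le_lt_trans _ (hN n Nn))//.
by rewrite [leRHS](big_cat_nat Nm mn)//= lerDr sumr_ge0// => *; exact: rnorm_ge0.
Qed.

End limits.

(** * Bounded linear operators *)

Section linear.
Variables (R : realType) (H : hilbertType R).
Implicit Types (T : H -> H).

Lemma lin0 T : linear T -> T 0 = 0.
Proof. by move=> lT; have := lT (-1) 0 0; rewrite scaler0 addr0 scaleN1r addNr. Qed.

Lemma linZ T a x : linear T -> T (a *: x) = a *: T x.
Proof. by move=> lT; rewrite -[a *: x]addr0 lT lin0// addr0. Qed.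

Lemma linD T x y : linear T -> T (x + y) = T x + T y.
Proof. by move=> lT; rewrite -[x in LHS]scale1r lT scale1r. Qed.

Lemma linB T x y : linear T -> T (x - y) = T x - T y.
Proof. by move=> lT; rewrite linD// -scaleN1r linZ// scaleN1r. Qed.

Lemma lin_sum T I (r : seq I) P (F : I -> H) : linear T ->
  T (\sum_(i <- r | P i) F i) = \sum_(i <- r | P i) T (F i).
Proof. by move=> lT; apply: (big_morph T) => [x y|]; rewrite ?linD ?lin0. Qed.

Lemma bounded_opP T : bounded_op T ->
  exists C : R, 0 <= C /\ forall x, rnorm (T x) <= C * rnorm x.
Proof.
move=> [lT cT].
have /cvgrPdist_lt /(_ 1 ltr01) := cT 0.
rewrite lin0// => /nbhs_normP [e /= e0 h].
have eE : e = (complex.Re e)%:C by rewrite RRe_real// gtr0_real.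
have re0 : 0 < complex.Re e by rewrite -ltcR -eE.
set r := complex.Re e in eE re0.
exists (2 / r); split => [|x]; first by rewrite divr_ge0// ltW.
have [->|x0] := eqVneq x 0; first by rewrite lin0// !rnorm0 mulr0.
have nx0 : 0 < rnorm x.
  by rewrite lt_neqAle rnorm_ge0 andbT eq_sym; apply: contra_neq x0 => /rnorm0_eq0.
(* Scaling x by a gives norm r / 2, inside the ball of radius r. *)
pose a := r / (2 * rnorm x).
have a0 : 0 < a by rewrite divr_gt0// mulr_gt0.
have := h (a%:C *: x); rewrite /= !sub0r !normrN !rnormE eE ltcR.
rewrite -[X in _ -> _ < X](rmorph1 (real_complex R)) ltcR.
rewrite linZ// !rnormZ rnorm_real gtr0_norm// => h1.
have : a * rnorm x < r.
  by rewrite /a invfM mulrA mulfVK ?gt_eqF// ltr_pdivrMr// ltr_pMr// ltr1n.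
move=> /h1; rewrite mulrC -ltr_pdivlMr// => /ltW/le_trans; apply.
by rewrite div1r /a invf_div mulrAC.
Qed.

End linear.

(** * Unordered sums *)

Section unordered_sums.
Variables (R : realType) (I : choiceType) (E : set I).

Lemma has_sum_unique (f : I -> R[i]) (z z' : R[i]) :
  has_sum E f z -> has_sum E f z' -> z = z'.
Proof.
move=> hz hz'; apply/eqP; rewrite -subr_eq0; apply/eqP/rnorm0_eq0/eqP.
rewrite eq_le rnorm_ge0 andbT; apply/ler_addgt0Pl => e e0; rewrite addr0.
have [F [fF FE] hF] := hz _ (divr_gt0 e0 (ltr0n _ 2)).
have [F' [fF' FE'] hF'] := hz' _ (divr_gt0 e0 (ltr0n _ 2)).
have hU : fsets E (F `|` F').
  by split; [rewrite finite_setU|rewrite subUset].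
have := hF _ hU (@subsetUl _ _ _); have := hF' _ hU (@subsetUr _ _ _).
set S := \sum_(_ \in _) _; rewrite !rnormE !ltcR => h' h.
rewrite -(subrKA S) (le_trans (rnormD _ _))// rnormB [leRHS]splitr.
by rewrite lerD// ltW.
Qed.

Lemma has_sum0 : has_sum E (fun=> 0 : R[i]) 0.
Proof.
move=> e e0; exists set0; first exact: fsets_set0.
by move=> G _ _; rewrite fsbig1// subr0 normr0 (ltcR 0).
Qed.

Lemma has_sumD (f g : I -> R[i]) (z w : R[i]) :
  has_sum E f z -> has_sum E g w -> has_sum E (fun e => f e + g e) (z + w).
Proof.
move=> hz hz' e e0.
have [F [fF FE] hF] := hz _ (divr_gt0 e0 (ltr0n _ 2)).
have [F' [fF' FE'] hF'] := hz' _ (divr_gt0 e0 (ltr0n _ 2)).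
exists (F `|` F'); first by split; [rewrite finite_setU|rewrite subUset].
move=> G hG; rewrite subUset => -[FG F'G].
rewrite fsbig_split//; last exact: hG.1.
have := hF _ hG FG; have := hF' _ hG F'G; rewrite !rnormE !ltcR => h' h.
by rewrite opprD addrACA (le_lt_trans (rnormD _ _))// [ltRHS]splitr ltrD.
Qed.

Lemma has_sum_sum (n : nat) (f : nat -> I -> R[i]) (z : nat -> R[i]) :
  (forall k, has_sum E (f k) (z k)) ->
  has_sum E (fun e => \sum_(k < n) f k e) (\sum_(k < n) z k).
Proof.
move=> h; elim: n => [|n IH].
  rewrite big_ord0; have := has_sum0; congr has_sum; apply/funext => e.
  by rewrite big_ord0.
rewrite big_ord_recr/=; have := has_sumD IH (h n); congr has_sum.
by apply/funext => e; rewrite big_ord_recr.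
Qed.

End unordered_sums.

(** * Orthonormal bases *)

Section orthonormal.
Variables (R : realType) (H : hilbertType R) (E : set H).
Hypothesis onbE : orthonormal_basis E.
Implicit Types (x y : H) (s : seq H) (c : H -> R[i]).

Definition basis_seq s := uniq s /\ forall e, e \in s -> E e.

Definition lincomb s c : H := \sum_(e <- s) c e *: e.

Lemma basis_seq_fset_set (G : set H) :
  fsets E G -> basis_seq (enum_fset (fset_set G)).
Proof.
move=> [finG GE]; split; first exact: fset_uniq.
by move=> e; change (e \in fset_set G -> E e); rewrite in_fset_set// => /set_mem/GE.
Qed.

Lemma basis_seq_cat s1 s2 :
  basis_seq s1 -> basis_seq s2 -> basis_seq (undup (s1 ++ s2)).
Proof.
move=> [u1 E1] [u2 E2]; split; first exact: undup_uniq.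
by move=> e; rewrite mem_undup mem_cat => /orP[/E1|/E2].
Qed.

Lemma inner_lincomb s c f : basis_seq s -> E f ->
  inner (lincomb s c) f = if f \in s then c f else 0.
Proof.
move=> [us sE] Ef; rewrite inner_suml.
have h e : e \in s -> inner (c e *: e) f = if e == f then c f else 0.
  move=> /sE Ee; rewrite innerZl (onbE.1 _ _ Ee Ef).
  by case: eqVneq => [->|]; rewrite ?mulr1 ?mulr0.
rewrite (eq_big_seq _ h) -big_mkcond.
case: ifPn => fs; last first.
  by rewrite big_seq_cond big1// => e /andP[es /eqP ef]; rewrite -ef es in fs.
by rewrite -big_filter filter_pred1_uniq// big_seq1.
Qed.

Lemma inner_lincomb2 s s' c d : basis_seq s -> basis_seq s' -> {subset s' <= s} ->
  inner (lincomb s c) (lincomb s' d) = \sum_(e <- s') c e * (d e)^*.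
Proof.
move=> os os' ss'; rewrite inner_sumr; apply: eq_big_seq => e es'.
rewrite innerZr inner_lincomb// ?ss'// 1?mulrC//.
exact: os'.2.
Qed.

Lemma rnorm_lincomb s c : basis_seq s ->
  rnorm (lincomb s c) ^+ 2 = \sum_(e <- s) rnorm (c e) ^+ 2.
Proof.
move=> os; apply: complexI; rewrite -innerE inner_lincomb2// rmorph_sum/=.
by apply: eq_bigr => e _; rewrite rnorm_sqr.
Qed.

Lemma rnorm_lincombB s s' c : basis_seq s -> basis_seq s' -> {subset s' <= s} ->
  rnorm (lincomb s c - lincomb s' c) ^+ 2 =
  \sum_(e <- s) rnorm (c e) ^+ 2 - \sum_(e <- s') rnorm (c e) ^+ 2.
Proof.
move=> os os' ss'; apply: complexI.
have sumE r : \sum_(e <- r) c e * (c e)^* = (\sum_(e <- r) rnorm (c e) ^+ 2)%:C.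
  by rewrite rmorph_sum/=; apply: eq_bigr => e _; rewrite rnorm_sqr.
rewrite -innerE innerBl !innerBr [inner (lincomb s' c) (lincomb s c)]inner_conj.
by rewrite !inner_lincomb2// !sumE conjc_real subrr subr0 rmorphB.
Qed.

Lemma rnorm_approx x s c : basis_seq s -> (forall e, E e -> inner x e = c e) ->
  rnorm (x - lincomb s c) ^+ 2 = rnorm x ^+ 2 - \sum_(e <- s) rnorm (c e) ^+ 2.
Proof.
move=> os xc; apply: complexI.
have sumE r : \sum_(e <- r) c e * (c e)^* = (\sum_(e <- r) rnorm (c e) ^+ 2)%:C.
  by rewrite rmorph_sum/=; apply: eq_bigr => e _; rewrite rnorm_sqr.
have xs : inner x (lincomb s c) = (\sum_(e <- s) rnorm (c e) ^+ 2)%:C.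
  rewrite inner_sumr -sumE; apply: eq_big_seq => e es.
  by rewrite innerZr (xc _ (os.2 _ es)) mulrC.
rewrite -innerE innerBl !innerBr [inner (lincomb s c) x]inner_conj xs.
by rewrite inner_lincomb2// sumE conjc_real innerE subrr subr0 rmorphB.
Qed.

Lemma bessel x s : basis_seq s ->
  \sum_(e <- s) rnorm (inner x e) ^+ 2 <= rnorm x ^+ 2.
Proof.
by move=> os; rewrite -subr_ge0 -(@rnorm_approx _ _ (inner x)) ?sqr_ge0.
Qed.

(** The source of all representation results below.  Choose finite sublists
    s_n of E along which the sums of |c e|^2 approach their supremum.  What any
    further basis vectors contribute is then small, so that the combinations
    over s_n form a Cauchy sequence, and a basis vector missing from s_n has a
    small coefficient, so that the limit has the coefficients c.  Only the s_n
    are enumerated: E may be uncountable. *)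
Lemma riesz_fischer c (M : R) :
  (forall s, basis_seq s -> \sum_(e <- s) rnorm (c e) ^+ 2 <= M) ->
  exists p, (forall e, E e -> inner p e = c e) /\
    forall eps : R, 0 < eps -> exists2 s, basis_seq s & rnorm (p - lincomb s c) < eps.
Proof.
move=> cM.
pose Q s := \sum_(e <- s) rnorm (c e) ^+ 2.
pose A := [set Q s | s in basis_seq].
have supA : has_sup A.
  split; first by exists (Q [::]); exists [::].
  by exists M => _ [s os <-]; exact: cM.
have Qle s : basis_seq s -> Q s <= sup A.
  by move=> os; apply: ub_le_sup; [exact: supA.2|exists s].
have /choice[s hs] n : exists s, basis_seq s /\ sup A - (n.+1%:R)^-1 < Q s.
  have [|_ [s os <-] h] := @sup_adherent _ _ (n.+1%:R)^-1 _ supA.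
    by rewrite invr_gt0.
  by exists s.
have close n t : basis_seq t -> {subset s n <= t} ->
    rnorm (lincomb t c - lincomb (s n) c) ^+ 2 < n.+1%:R^-1.
  move=> ot st; have [os h] := hs n; rewrite rnorm_lincombB//.
  by rewrite ltrBlDr (le_lt_trans (Qle _ ot))// addrC -ltrBlDr.
have small (e : R) : 0 < e -> exists N, forall n, (N <= n)%N -> n.+1%:R^-1 < e ^+ 2.
  move=> e0; have [N hN] := ltr_add_invr (exprn_gt0 2 e0); exists N => n Nn.
  rewrite add0r in hN.
  by apply: le_lt_trans hN; rewrite lef_pV2 ?posrE// ler_nat.
have sqrt_lt (a e : R) : 0 <= a -> 0 < e -> a ^+ 2 < e ^+ 2 -> a < e.
  by move=> a0 e0; rewrite ltr_pXn2r// nnegrE// ltW.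
have [p sp] : exists p, ncvg (fun n => lincomb (s n) c) p.
  apply: cauchy_ncvg => e e0.
  have [N hN] := small (e / 2) (divr_gt0 e0 (ltr0n _ 2)).
  exists N => m n Nm Nn.
  set t := undup (s m ++ s n).
  have ot : basis_seq t by apply: basis_seq_cat; [exact: (hs m).1|exact: (hs n).1].
  have cl k : (N <= k)%N -> {subset s k <= t} ->
      rnorm (lincomb t c - lincomb (s k) c) < e / 2.
    move=> Nk sk; apply: sqrt_lt; rewrite ?rnorm_ge0 ?divr_gt0//.
    by rewrite (lt_trans (close _ _ ot sk))// hN.
  rewrite -(subrKA (lincomb t c)) (le_lt_trans (rnormD _ _))// rnormB [ltRHS]splitr.
  by rewrite ltrD// cl// => f fs; rewrite mem_undup mem_cat fs ?orbT.
exists p; split => [e Ee|eps eps0]; last first.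
  by have [N hN] := (ncvgP _ _).1 sp _ eps0; exists (s N); [exact: (hs N).1|exact: hN].
apply: (@ncvg_unique _ _ (fun n => inner (lincomb (s n) c) e)).
  apply: (ncvg_le (C := rnorm e) sp) => n.
  by rewrite -innerBl mulrC cauchy_schwarz.
apply/ncvgP => eps eps0; have [N hN] := small _ eps0.
exists N => n Nn; rewrite inner_lincomb//; last exact: (hs n).1.
case: ifPn => es; first by rewrite subrr rnorm0.
rewrite subr0; apply: sqrt_lt; rewrite ?rnorm_ge0// (lt_trans _ (hN _ Nn))//.
have [[un snE] hn] := hs n.
(* Adding e to s n cannot take the sum of squares beyond its supremum. *)
have oes : basis_seq (e :: s n).
  split; first by rewrite /= es un.
  by move=> f; rewrite in_cons => /predU1P[->|/snE].
have := Qle _ oes; rewrite /Q big_cons => h.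
by rewrite -(ltrD2r (Q (s n))) (le_lt_trans h)// addrC -ltrBlDr.
Qed.

(** The vector built from the coefficients of x by [riesz_fischer] has the same
    coefficients as x, hence is x, since E is maximal. *)
Lemma lincomb_dense x (eps : R) : 0 < eps ->
  exists2 s, basis_seq s & rnorm (x - lincomb s (inner x)) < eps.
Proof.
have [p [pe hp]] := riesz_fischer (bessel x).
suff px : p = x by rewrite px in hp; exact: hp.
apply/eqP; rewrite -subr_eq0; apply/eqP; apply: onbE.2 => e Ee.
by rewrite innerBl pe// subrr.
Qed.

(** Makes approximations improve along inclusion, as the nets behind
    [has_sum] require. *)
Lemma best_approx x s s' : basis_seq s -> basis_seq s' -> {subset s' <= s} ->
  rnorm (x - lincomb s (inner x)) <= rnorm (x - lincomb s' (inner x)).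
Proof.
move=> os os' ss'; rewrite -(@ler_pXn2r _ 2)// ?nnegrE ?rnorm_ge0//.
rewrite !rnorm_approx// lerD2l lerN2; apply: sum_subset_le => //.
- by move=> e; exact: sqr_ge0.
- exact: os.1.
- exact: os'.1.
Qed.

Lemma rnorm_proj_le x s : basis_seq s -> rnorm (lincomb s (inner x)) <= rnorm x.
Proof.
move=> os; rewrite -(@ler_pXn2r _ 2)// ?nnegrE ?rnorm_ge0//.
by rewrite rnorm_lincomb// bessel.
Qed.

Lemma bounded_eq_onb (S T : H -> H) : bounded_op S -> bounded_op T ->
  (forall e, E e -> S e = T e) -> S = T.
Proof.
move=> bS bT ST; apply/funext => x.
have [C [C0 hC]] := bounded_opP bS; have [D [D0 hD]] := bounded_opP bT.
apply/eqP; rewrite -subr_eq0; apply/eqP/rnorm0_eq0/eqP.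
rewrite eq_le rnorm_ge0 andbT; apply/ler_addgt0Pl => eps eps0; rewrite addr0.
have CD : 0 < C + D + 1 by rewrite ltr_wpDl// addr_ge0.
have [s [us sE] hs] := lincomb_dense x (divr_gt0 eps0 CD).
set y := lincomb s _ in hs.
have STy : S y = T y.
  rewrite /y /lincomb (lin_sum _ _ _ bS.1) (lin_sum _ _ _ bT.1).
  apply: eq_big_seq => e es.
  by rewrite (linZ _ _ bS.1) (linZ _ _ bT.1) ST//; exact: sE.
have -> : S x - T x = S (x - y) - T (x - y).
  by rewrite (linB _ _ bS.1) (linB _ _ bT.1) STy opprB subrKA.
rewrite (le_trans (rnormD _ _))// rnormN (le_trans (lerD (hC _) (hD _)))//.
rewrite -mulrDl; rewrite ltr_pdivlMr// mulrC in hs; apply/ltW/(le_lt_trans _ hs).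
by rewrite ler_wpM2r ?rnorm_ge0// lerDl.
Qed.

Lemma parseval x y :
  has_sum E (fun e => inner x e * inner e y) (inner x y).
Proof.
move=> eps eps0.
(* The + 1 keeps the divisor positive when y = 0. *)
have ny : 0 < rnorm y + 1 by rewrite ltr_wpDl// rnorm_ge0.
have [s os hs] := lincomb_dense x (divr_gt0 eps0 ny).
exists [set` s]; first by split; [exact: finite_seq|move=> e /=; exact: os.2].
move=> G hG sG; rewrite fsbig_finite; last exact: hG.1.
have oG := basis_seq_fset_set hG.
rewrite rnormE ltcR.
have -> : \sum_(e <- fset_set G) inner x e * inner e y =
    inner (lincomb (enum_fset (fset_set G)) (inner x)) y.
  by rewrite inner_suml; apply: eq_bigr => e _; rewrite innerZl.
rewrite -innerBl (le_lt_trans (cauchy_schwarz _ _))// rnormB.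
rewrite ltr_pdivlMr// in hs; apply: le_lt_trans hs.
rewrite ler_pM ?rnorm_ge0//; last by rewrite lerDl.
apply: best_approx => //.
move=> e es; change (e \in fset_set G); rewrite in_fset_set ?in_setE.
- exact: sG.
- exact: hG.1.
Qed.

(** The coefficients of the representing vector must be the conjugates of
    phi(e); testing phi on their finite combinations bounds their sums of
    squares by C^2, so that [riesz_fischer] applies. *)
Lemma riesz (phi : H -> R[i]) (C : R) :
  (forall a x y, phi (a *: x + y) = a * phi x + phi y) ->
  (forall x, rnorm (phi x) <= C * rnorm x) ->
  exists z, forall x, phi x = inner x z.
Proof.
move=> lphi hC.
have phi0 : phi 0 = 0.
  by have := lphi (-1) 0 0; rewrite scaler0 addr0 mulN1r addNr.
have phi_comb s c : phi (lincomb s c) = \sum_(e <- s) c e * phi e.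
  elim: s => [|e s IH]; rewrite /lincomb ?big_nil// !big_cons lphi -IH//.
have [|z [hz _]] := @riesz_fischer (fun e => (phi e)^*) (C ^+ 2).
  move=> s os; set Q := \sum_(_ <- _) _.
  have Q0 : 0 <= Q by apply: sumr_ge0 => *; exact: sqr_ge0.
  have := hC (lincomb s (fun e => (phi e)^*)).
  have -> : phi (lincomb s (fun e => (phi e)^*)) = Q%:C.
    rewrite phi_comb rmorph_sum/=; apply: eq_bigr => e _.
    by rewrite rnorm_conj rnorm_sqr mulrC.
  rewrite rnorm_real ger0_norm// => h.
  (* |phi y| <= C |y| at y = sum conj (phi e) e, where phi y = |y|^2 = Q. *)
  have h2 : Q ^+ 2 <= C ^+ 2 * Q.
    rewrite /Q -rnorm_lincomb// -exprMn rnorm_lincomb// -/Q.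
    by rewrite ler_pXn2r ?nnegrE// (le_trans Q0).
  have [->|Qn0] := eqVneq Q 0; first exact: sqr_ge0.
  by rewrite -(@ler_pM2r _ Q) ?lt_neqAle ?Q0 1?eq_sym ?Qn0.
exists z => x.
have ze e : E e -> inner e z = phi e.
  by move=> Ee; rewrite inner_conj hz// conjcK.
apply/eqP; rewrite -subr_eq0; apply/eqP/rnorm0_eq0/eqP.
rewrite eq_le rnorm_ge0 andbT; apply/ler_addgt0Pl => eps eps0; rewrite addr0.
have C0 : 0 < `|C| + rnorm z + 1 by rewrite ltr_wpDl// addr_ge0 ?rnorm_ge0.
have [s os hs] := lincomb_dense x (divr_gt0 eps0 C0).
set y := lincomb s _ in hs.
have yE : phi y = inner y z.
  rewrite phi_comb inner_suml; apply: eq_big_seq => e es.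
  by rewrite innerZl ze//; exact: os.2.
have -> : phi x - inner x z = phi (x - y) - inner (x - y) z.
  have -> : x - y = (-1) *: y + x by rewrite scaleN1r addrC.
  rewrite lphi yE innerDl innerZl; ring.
rewrite (le_trans (rnormD _ _))// rnormN.
rewrite (le_trans (lerD (hC _) (cauchy_schwarz _ _)))//.
rewrite ltr_pdivlMr// mulrC in hs; apply/ltW/(le_lt_trans _ hs).
rewrite [X in _ + X]mulrC -mulrDl ler_wpM2r ?rnorm_ge0//.
by rewrite -addrA lerD ?ler_norm// lerDl.
Qed.

End orthonormal.

(** * Adjoints *)

Section adjoint.
Variables (R : realType) (H : hilbertType R).
Implicit Types (x y : H) (T : H -> H).

Lemma adjP T : bounded_op T -> forall x y, inner (T x) y = inner x (adj T y).
Proof.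
move=> bT x y; rewrite /adj; move: x.
suff [z hz] : exists z, forall x, inner (T x) y = inner x z.
  by case: xgetP => [_ -> //|/(_ z)].
have [C [C0 hC]] := bounded_opP bT; have [E hE] := orthonormal_basis_exists H.
apply: (riesz hE (C := C * rnorm y)) => [a u v|u].
  by rewrite bT.1 inner_linearl.
by rewrite (le_trans (cauchy_schwarz _ _))// mulrAC ler_wpM2r ?rnorm_ge0.
Qed.

Lemma adj_le T (C : R) : bounded_op T -> 0 <= C ->
  (forall x, rnorm (T x) <= C * rnorm x) ->
  forall y, rnorm (adj T y) <= C * rnorm y.
Proof.
move=> bT C0 hC y; set z := adj T y.
have [z0|z0] := eqVneq (rnorm z) 0; first by rewrite z0 mulr_ge0 ?rnorm_ge0.
have zp : 0 < rnorm z by rewrite lt_neqAle eq_sym z0 rnorm_ge0.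
rewrite -(@ler_pM2r _ (rnorm z))//.
have -> : rnorm z * rnorm z = rnorm (inner (T z) y).
  by rewrite adjP// innerE rnorm_real ger0_norm ?sqr_ge0.
rewrite (le_trans (cauchy_schwarz _ _))// mulrAC ler_wpM2r ?rnorm_ge0//.
Qed.

End adjoint.

(** * The trace of a nuclear operator *)

Section nuclear.
Variables (R : realType) (H : hilbertType R).

(** Summed over a finite set G of basis vectors, the k-th term contributes
    <P_G a_k, b_k>, where P_G is the orthogonal projection onto the span of G;
    it is at most |a_k| |b_k| whatever G is.  So the tails are
    small uniformly in G, and only finitely many terms are left, for which
    Parseval's identity gives the limit over G. *)
Lemma nuclear_trace (S : H -> H) (a b : nat -> H) (M : R) (z : R[i]) :
  (forall n, \sum_(k < n) rnorm (a k) * rnorm (b k) <= M) ->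
  (forall x y, ncvg (fun n => \sum_(k < n) inner x (b k) * inner (a k) y)
                 (inner (S x) y)) ->
  ncvg (fun n => \sum_(k < n) inner (a k) (b k)) z ->
  has_trace S z.
Proof.
move=> abM hS hz E hE eps eps0.
(* Three errors are added: two tails beyond N, and the first N terms over G. *)
have e4 : 0 < eps / 4 by rewrite divr_gt0.
have ab0 k : 0 <= rnorm (a k) * rnorm (b k) by rewrite mulr_ge0 ?rnorm_ge0.
have [N hN] := bounded_sum_tail ab0 abM e4.
have [F hF hFN] := has_sum_sum N (fun k => parseval hE (a k) (b k)) e4.
exists F => // G hG FG.
have := hFN G hG FG; rewrite !fsbig_finite; try exact: hG.1.
set s := enum_fset (fset_set G); set P := \sum_(e <- s) \sum_(k < N) _.
set q := \sum_(k < N) _; set t := \sum_(e <- s) inner _ _.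
have os : basis_seq E s by exact: basis_seq_fset_set.
rewrite !rnormE !ltcR => hP.
have ht : rnorm (t - P) <= eps / 4.
  have ts : ncvg (fun n => \sum_(e <- s)
      \sum_(k < n) inner e (b k) * inner (a k) e) t.
    exact: (ncvg_sum s (fun e => hS e e)).
  apply: (ncvg_rnorm_le (N := N) (ncvgB_cst P ts)) => n Nn.
  apply/ltW/(le_lt_trans _ (hN n Nn)).
  have -> : \sum_(e <- s) \sum_(k < n) inner e (b k) * inner (a k) e - P =
      \sum_(N <= k < n) inner (lincomb s (inner (a k))) (b k).
    rewrite /P -sumrB.
    transitivity (\sum_(e <- s) \sum_(N <= k < n) inner (a k) e * inner e (b k)).
      apply: eq_bigr => e _; rewrite -sum_ord_cat//; congr (_ - _).
      by apply: eq_bigr => k _; rewrite mulrC.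
    rewrite exchange_big/=; apply: eq_bigr => k _.
    by rewrite inner_suml; apply: eq_bigr => e _; rewrite innerZl.
  rewrite (le_trans (rnorm_sum _ _ _))//; apply: ler_sum => k _.
  by rewrite (le_trans (cauchy_schwarz _ _))// ler_wpM2r ?rnorm_ge0// (rnorm_proj_le hE).
have hq : rnorm (z - q) <= eps / 4.
  apply: (ncvg_rnorm_le (N := N) (ncvgB_cst q hz)) => n Nn.
  apply/ltW/(le_lt_trans _ (hN n Nn)).
  rewrite /q (sum_ord_cat (fun k => inner (a k) (b k)) Nn).
  rewrite (le_trans (rnorm_sum _ _ _))//; apply: ler_sum => k _.
  exact: cauchy_schwarz.
have -> : t - z = (t - P) + ((P - q) + (q - z)) by ring.
rewrite (le_lt_trans (rnormD _ _))//.
rewrite (le_lt_trans (lerD ht (rnormD _ _)))//.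
rewrite rnormB in hq; lra.
Qed.

End nuclear.

(** * Cholesky factorization of a positive operator *)

Section positive.
Variables (R : realType) (H : hilbertType R) (A : H -> H).
Hypothesis lA : linear A.
Hypothesis pos : forall x, 0 <= inner (A x) x.

Let form x : R := complex.Re (inner (A x) x).

Lemma formE x : inner (A x) x = (form x)%:C.
Proof. by rewrite /form RRe_real// ger0_real. Qed.

Lemma form_ge0 x : 0 <= form x.
Proof. by rewrite -(lecR 0) -formE. Qed.

(** Polarization: the form is real at x + y and at x + iy. *)
Lemma positive_hermitian x y : inner (A x) y = (inner (A y) x)^*.
Proof.
have := ger0_Im (pos (x + y)).
have := ger0_Im (pos (x + 'i *: y)).
rewrite !(linD _ _ lA, linZ _ _ lA) !(innerDl, innerDr, innerZl, innerZr) !formE.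
move: (inner (A x) y) (inner (A y) x) (form x) (form y) => [p p'] [q q'] fx fy /=.
rewrite !(mul0r, mul1r, mulN1r, mulr0, addr0, add0r, subr0, oppr0, opprK, sub0r, mulr1).
move=> h1 h2; apply/eqP; rewrite eq_complex /=; apply/andP; split; apply/eqP; lra.
Qed.

(** Positivity at x - tAx for every real t leaves no room for Ax <> 0 when
    <Ax, x> = 0. *)
Lemma positive_ker x : inner (A x) x = 0 -> A x = 0.
Proof.
move=> Axx; apply: rnorm0_eq0; set q := rnorm (A x).
have hq (t : R) : 0 <= t ^+ 2 * form (A x) - 2 * t * q ^+ 2.
  have := pos (x - t%:C *: A x).
  rewrite !(linB _ _ lA, linZ _ _ lA) !(innerBl, innerBr, innerZl, innerZr).
  rewrite (positive_hermitian (A x) x) Axx formE !innerE !conjc_real -/q.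
  rewrite sub0r -(lecR 0) => /le_trans; apply.
  rewrite le_eqVlt; apply/orP; left; apply/eqP.
  rewrite rmorphB !rmorphM/= rmorph_nat; ring.
set c := form (A x) in hq; have c0 : 0 <= c by exact: form_ge0.
have c1 : 0 < c + 1 by lra.
(* For this t the quadratic term stays below the linear one. *)
clear Axx; have := hq (q ^+ 2 / (c + 1)).
have -> : (q ^+ 2 / (c + 1)) ^+ 2 * c - 2 * (q ^+ 2 / (c + 1)) * q ^+ 2
  = - ((q ^+ 2 / (c + 1)) ^+ 2 * (c + 2)) by field; rewrite gt_eqF.
rewrite oppr_ge0 pmulr_lle0; last by rewrite ltr_wpDl.
move=> h; have /eqP : (q ^+ 2 / (c + 1)) ^+ 2 = 0.
  by apply/eqP; rewrite eq_le h sqr_ge0.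
by rewrite expf_eq0/= mulf_eq0 invr_eq0 (gt_eqF c1) orbF expf_eq0/= => /eqP.
Qed.

Variable e : nat -> H.

(** The inverse of 0 being 0, [normalize] sends the vectors of zero form to 0:
    in Gram-Schmidt below, a vector that depends on its predecessors modulo the
    kernel of A contributes 0. *)
Definition normalize x : H := ((Num.sqrt (form x))^-1)%:C *: x.

(** Gram-Schmidt for the form <Ax, y> in recursive shape: [residual n x] is what
    remains of x after its components along the first n vectors have been
    removed, and the next vector is the normalized residual of e_n.  See
    [residualE] for the usual closed form. *)
Fixpoint residual (n : nat) (x : H) : H :=
  match n with
  | 0 => x
  | m.+1 => residual m x -
      inner (A x) (normalize (residual m (e m))) *: normalize (residual m (e m))
  end.

Definition gram_schmidt (n : nat) : H := normalize (residual n (e n)).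

Lemma residualS n x :
  residual n.+1 x = residual n x - inner (A x) (gram_schmidt n) *: gram_schmidt n.
Proof. by []. Qed.

Lemma residualE n x :
  residual n x = x - \sum_(k < n) inner (A x) (gram_schmidt k) *: gram_schmidt k.
Proof.
elim: n => [|n IH]; first by rewrite big_ord0 subr0.
by rewrite residualS IH big_ord_recr/= opprD addrA.
Qed.

Lemma normalizeP x :
  (A x = 0 /\ normalize x = 0) \/
  (inner (A (normalize x)) (normalize x) = 1 /\
   inner (A x) (normalize x) *: normalize x = x).
Proof.
have [f0|f0] := eqVneq (form x) 0.
  left; split; first by apply: positive_ker; rewrite formE f0.
  by rewrite /normalize f0 sqrtr0 invr0 scale0r.
right; rewrite /normalize (linZ _ _ lA) !(innerZl, innerZr) formE conjc_real.
set r := Num.sqrt _.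
have r0 : r != 0 by rewrite sqrtr_eq0 -ltNge lt_neqAle eq_sym f0 form_ge0.
have -> : form x = r ^+ 2 by rewrite sqr_sqrtr// form_ge0.
split.
  rewrite -[1](rmorph1 (real_complex R)) -!rmorphM; congr (_%:C).
  by field.
rewrite scalerA -!rmorphM -[RHS]scale1r -[1](rmorph1 (real_complex R)).
by congr (_%:C *: _); field.
Qed.

(** Residuals stay orthogonal, for the form, to the vectors already removed;
    the orthogonality of the f_k among themselves is the case x = e_n, as f_n is
    a multiple of the residual of e_n. *)
Lemma gram_schmidt_residual n k x : (k < n)%N ->
  inner (A (residual n x)) (gram_schmidt k) = 0.
Proof.
elim: n k x => // n IH k x.
rewrite residualS (linB _ _ lA) (linZ _ _ lA) innerBl innerZl.
have gs0 j : (j < n)%N -> inner (A (gram_schmidt n)) (gram_schmidt j) = 0.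
  by move=> jn; rewrite /gram_schmidt {1}/normalize (linZ _ _ lA) innerZl IH// mulr0.
rewrite ltnS leq_eqVlt => /predU1P[->|kn]; last by rewrite IH// gs0// mulr0 subr0.
rewrite residualE (linB _ _ lA) (lin_sum _ _ _ lA) innerBl inner_suml.
rewrite big1 ?subr0 => [|j _]; last first.
  by rewrite (linZ _ _ lA) innerZl (positive_hermitian (gram_schmidt j)) gs0// conjc0 mulr0.
case: (normalizeP (residual n (e n))) => [[_ g0]|[g1 _]].
  by rewrite /gram_schmidt g0 !inner0r mul0r subr0.
by rewrite [inner (A (gram_schmidt n)) _]g1 mulr1 subrr.
Qed.

Lemma gram_schmidt_innerE n x :
  inner (A (residual n x)) (gram_schmidt n) = inner (A x) (gram_schmidt n).
Proof.
rewrite residualE (linB _ _ lA) (lin_sum _ _ _ lA) innerBl inner_suml.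
rewrite big1 ?subr0// => j _.
rewrite (linZ _ _ lA) innerZl (positive_hermitian (gram_schmidt j)).
rewrite {1}/gram_schmidt {1}/normalize.
by rewrite (linZ _ _ lA) innerZl gram_schmidt_residual// mulr0 conjc0 mulr0.
Qed.

(** Step n removes all of e_n up to the kernel of A; from then on its
    coefficients vanish, by [gram_schmidt_innerE]. *)
Lemma residual_ker n m : (n < m)%N -> A (residual m (e n)) = 0.
Proof.
elim: m => // m IH; rewrite ltnS leq_eqVlt => /predU1P[->|nm]; last first.
  rewrite residualS -gram_schmidt_innerE IH// inner0l scale0r subr0; exact: IH.
rewrite residualS -gram_schmidt_innerE.
case: (normalizeP (residual m (e m))) => [[Ar _]|[_ h]].
  by rewrite Ar inner0l scale0r subr0.
by rewrite /gram_schmidt h subrr (lin0 lA).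
Qed.

(** Bessel's inequality for the form, which is nonnegative at the residual
    of x. *)
Lemma gram_schmidt_bessel n x :
  \sum_(k < n) rnorm (inner (A x) (gram_schmidt k)) ^+ 2 <= form x.
Proof.
have h : inner (A (residual n x)) (residual n x) =
    (form x - \sum_(k < n) rnorm (inner (A x) (gram_schmidt k)) ^+ 2)%:C.
  rewrite [X in inner _ X]residualE innerBr inner_sumr big1 ?subr0; last first.
    by move=> k _; rewrite innerZr gram_schmidt_residual ?mulr0.
  rewrite residualE (linB _ _ lA) (lin_sum _ _ _ lA) innerBl inner_suml.
  rewrite formE rmorphB rmorph_sum/=; congr (_ - _).
  apply: eq_bigr => k _.
  by rewrite (linZ _ _ lA) innerZl (positive_hermitian (gram_schmidt k)) rnorm_sqr.
by have := pos (residual n x); rewrite h (lecR 0) subr_ge0.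
Qed.

(** By Parseval the left-hand side is a double sum of
    |<Ax, f_k>|^2 over x in E and k < n; summing first over k,
    [gram_schmidt_bessel] bounds it by the sum of <Ax, x>. *)
Lemma gram_schmidt_trace (E : set H) (M : R) : orthonormal_basis E ->
  (forall s, basis_seq E s -> \sum_(x <- s) form x <= M) ->
  forall n, \sum_(k < n) rnorm (A (gram_schmidt k)) ^+ 2 <= M.
Proof.
move=> hE EM n; apply/ler_addgt0Pl => eps eps0.
have [F hF /(_ F hF (@subset_refl _ _))] :=
  has_sum_sum n (fun k => parseval hE (A (gram_schmidt k)) (A (gram_schmidt k))) eps0.
rewrite fsbig_finite; last exact: hF.1.
set s := enum_fset (fset_set F).
have -> : \sum_(x <- s) \sum_(k < n)
     inner (A (gram_schmidt k)) x * inner x (A (gram_schmidt k))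
   = (\sum_(x <- s) \sum_(k < n) rnorm (inner (A x) (gram_schmidt k)) ^+ 2)%:C.
  rewrite rmorph_sum/=; apply: eq_bigr => x _; rewrite rmorph_sum/=; apply: eq_bigr => k _.
  rewrite rnorm_sqr (positive_hermitian (gram_schmidt k) x) [inner x _]inner_conj.
  by rewrite (positive_hermitian (gram_schmidt k) x) conjcK mulrC.
have -> : \sum_(k < n) inner (A (gram_schmidt k)) (A (gram_schmidt k)) =
   (\sum_(k < n) rnorm (A (gram_schmidt k)) ^+ 2)%:C.
  by rewrite rmorph_sum/=; apply: eq_bigr => k _; rewrite innerE.
rewrite -rmorphB rnormE ltcR rnorm_real => /ltr_distlCBl/ltW; rewrite lerBlDr => h.
rewrite addrC (le_trans h)// lerD2r; apply: le_trans (EM s _).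
  by apply: ler_sum => x _; exact: gram_schmidt_bessel.
exact: basis_seq_fset_set.
Qed.

(** For each n only finitely many vectors of E have form above 1/(n + 1). *)
Lemma form_support_countable (E : set H) (M : R) :
  (forall s, basis_seq E s -> \sum_(x <- s) form x <= M) ->
  countable [set x | E x /\ form x != 0].
Proof.
move=> EM.
have -> : [set x | E x /\ form x != 0] =
    \bigcup_(n in [set: nat]) [set x | E x /\ n.+1%:R^-1 < form x].
  apply/seteqP; split => [x [Ex fx]|x [n _ [Ex fx]]]; last first.
    by split=> //; rewrite gt_eqF// (lt_trans _ fx)// invr_gt0.
  have fx0 : 0 < form x by rewrite lt_neqAle eq_sym fx form_ge0.
  have [n hn] := ltr_add_invr fx0; exists n => //; split => //.
  by rewrite add0r in hn.
apply: bigcup_countable => // n _; apply: finite_set_countable.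
apply: contrapT => inf.
(* N terms above 1/(n + 1) would add up to more than M. *)
pose N := (Num.truncn (M * n.+1%:R)).+1.
have [X XE NX] := infinite_set_fset N inf.
have oX : basis_seq E (enum_fset X).
  by split; [exact: fset_uniq|move=> x /XE[]].
have := EM _ oX; rewrite leNgt => /negP; apply.
have MN : M < N%:R * n.+1%:R^-1.
  by rewrite ltr_pdivlMr// truncnS_gt.
apply: (lt_le_trans MN).
apply: (@le_trans _ _ (\sum_(x <- enum_fset X) n.+1%:R^-1)).
  rewrite big_const_seq count_predT iter_addr_0 -[leRHS]mulr_natl.
  rewrite ler_wpM2r ?invr_ge0// ler_nat.
  exact: NX.
rewrite !big_seq; apply: ler_sum => x xX.
by apply/ltW; have [] := XE _ xX.
Qed.

End positive.

(** * Trace class operators are nuclear *)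

Section trace_class.
Variables (R : realType) (H : hilbertType R).

Lemma countable_enum (S : set H) : countable S ->
  exists e : nat -> H, forall x, S x -> exists n, e n = x.
Proof.
move=> /countable_injP[g gi]; exists (fun n => xget 0 [set x | S x /\ g x = n]).
move=> x Sx; exists (g x); case: xgetP => [y -> [Sy gy]|/(_ x)]; last by case.
by apply: gi => //; exact: mem_set.
Qed.

(** |Tx|^2 = <T^* T x, x> = <A A x, x> = |Ax|^2. *)
Lemma rnorm_abs (T A : H -> H) : bounded_op T -> is_abs T A ->
  forall x, rnorm (T x) = rnorm (A x).
Proof.
move=> bT [bA pos AT] x.
apply/eqP; rewrite -(@eqrXn2 _ 2) ?rnorm_ge0//; apply/eqP; apply: complexI.
rewrite -!innerE adjP//.
have := congr1 (fun f => f x) AT => /= <-.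
by rewrite [RHS](positive_hermitian bA.1 pos) -inner_conj.
Qed.

(** With f_k the Gram-Schmidt vectors for A = |T|, take u_k = T f_k and
    v_k = A f_k.  On a basis vector the series is a finite sum: the residual
    eventually lies in the kernel of A, which is also the kernel of T. *)
Lemma trace_class_nuclear (T : H -> H) : trace_class T ->
  exists (E : set H) (u v : nat -> H) (M : R),
    [/\ orthonormal_basis E,
        forall n, \sum_(k < n) rnorm (u k) * rnorm (v k) <= M &
        forall x, E x ->
          ncvg (fun n => \sum_(k < n) inner x (v k) *: u k) (T x)].
Proof.
move=> [bT [A absA [E hE fin]]].
have TA := rnorm_abs bT absA; have [bA pos _] := absA; have lA := bA.1.
pose form x := complex.Re (inner (A x) x).
have [M EM] : exists M, forall s, basis_seq E s -> \sum_(x <- s) form x <= M.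
  set S := (\esum_(e in E) _)%E in fin.
  have le s : basis_seq E s -> ((\sum_(x <- s) form x)%:E <= S)%E.
    move=> [us sE]; apply: esum_ge; exists [set` s].
      by split; [exact: finite_seq|exact: sE].
    by rewrite -fsbig_seq// sumEFin.
  have Sfin : S \is a fin_num.
    rewrite ge0_fin_numE//; have := le [::]; rewrite big_nil; apply.
    by split.
  by exists (fine S) => s /le; rewrite -{1}(fineK Sfin) lee_fin.
have [e he] := countable_enum (form_support_countable pos EM).
pose f := gram_schmidt A e; exists E, (T \o f), (A \o f), M; split=> //.
  move=> n; apply: le_trans (gram_schmidt_trace lA pos e hE EM n).
  by apply: ler_sum => k _; rewrite /= TA expr2.
move=> x Ex.
have [n0 hn0] : exists n0, forall n, (n0 <= n)%N -> A (residual A e n x) = 0.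
  have [fx|fx] := eqVneq (form x) 0; last first.
    have [n0 <-] := he x (conj Ex fx); exists n0.+1 => n; exact: residual_ker.
  have Ax : A x = 0 by apply: positive_ker => //; rewrite formE// -/(form x) fx.
  exists 0%N => n _; rewrite residualE Ax big1 ?subr0// => k _.
  by rewrite inner0l scale0r.
apply: (ncvg_near_const (N := n0)) => n /hn0 An.
have : T (residual A e n x) = 0 by apply: rnorm0_eq0; rewrite TA An rnorm0.
rewrite residualE (linB _ _ bT.1) (lin_sum _ _ _ bT.1) => /eqP.
rewrite subr_eq0 => /eqP ->; apply: eq_bigr => k _.
by rewrite (linZ _ _ bT.1) [inner (A x) _](positive_hermitian lA pos) -inner_conj.
Qed.

End trace_class.

(** * The unitary Lambda *)

Section Lambda.
Variables (R : realType) (H W : hilbertType R) (tens : H -> conjugate H -> W).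
Variables (Lambda : W -> H -> H).
Hypothesis LambdaP : is_Lambda tens Lambda.

Lemma Lambda_bounded w : bounded_op (Lambda w).
Proof.
have [_ rL _ _] := LambdaP.
have : range Lambda (Lambda w) by exists w.
by rewrite rL => -[].
Qed.

(** The trace identity for w and y (x) x reads
    <w, y (x) x> = Tr (Lambda w o adj (<., x> y)); as the adjoint of
    <., x> y is <., y> x, the trace is the Parseval sum of
    <Lambda w x, e> <e, y>.  Besides identifying Lambda w, this replaces any
    continuity statement for Lambda. *)
Lemma inner_Lambda w x y : inner (Lambda w x) y = inner w (tens y x).
Proof.
have [_ _ trL Lt] := LambdaP; have [E hE] := orthonormal_basis_exists H.
apply: (has_sum_unique (parseval hE (Lambda w x) y)).
have := trL w (tens y x) E hE; congr has_sum; apply/funext => e /=.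
suff -> : adj (Lambda (tens y x)) e = inner e y *: x.
  by rewrite (linZ _ _ (Lambda_bounded w).1) innerZl mulrC.
apply: inner_inj => z; rewrite inner_conj [RHS]inner_conj; congr (_^*).
rewrite -(adjP (Lambda_bounded _)) Lt innerZl innerZr.
by rewrite -inner_conj mulrC.
Qed.

Lemma Lambda_inj : injective Lambda.
Proof.
move=> w w' ww'; apply: inner_inj => w''; have [_ _ trL _] := LambdaP.
have [E hE] := orthonormal_basis_exists H.
by have := trL w w'' E hE; rewrite ww' => /has_sum_unique; apply; exact: trL.
Qed.

Hypothesis tensP : forall u v u' v',
  inner (tens u v) (tens u' v') = inner u u' * inner v v'.

Lemma rnorm_tens u v : rnorm (tens u v) = rnorm u * rnorm (v : H).
Proof.
apply/eqP; rewrite -(@eqrXn2 _ 2) ?rnorm_ge0 ?mulr_ge0 ?rnorm_ge0//; apply/eqP.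
by apply: complexI; rewrite -innerE tensP !innerE exprMn [RHS]rmorphM.
Qed.

(** The matrix entries of Lambda w are limits of those of the partial sums, by
    [inner_Lambda].  They need only be compared with those of T on E, since
    bounded operators are determined by their values there. *)
Lemma nuclear_Lambda (T : H -> H) E (u v : nat -> H) (M : R) :
  bounded_op T -> orthonormal_basis E ->
  (forall n, \sum_(k < n) rnorm (u k) * rnorm (v k) <= M) ->
  (forall x, E x -> ncvg (fun n => \sum_(k < n) inner x (v k) *: u k) (T x)) ->
  exists2 w, Lambda w = T & ncvg (fun n => \sum_(k < n) tens (u k) (v k)) w.
Proof.
move=> bT hE uvM hT.
have [w hw] : exists w, ncvg (fun n => \sum_(k < n) tens (u k) (v k)) w.
  apply: (@abs_series_ncvg R W (fun k => tens (u k) (v k)) M) => n.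
  by under eq_bigr do rewrite rnorm_tens.
exists w => //; apply: (bounded_eq_onb hE (Lambda_bounded w) bT) => e Ee.
apply: inner_inj => y; rewrite inner_Lambda.
apply: (@ncvg_unique _ _ (fun n => inner (\sum_(k < n) tens (u k) (v k)) (tens y e))).
  apply: (ncvg_le (C := rnorm (tens y e)) hw) => n.
  by rewrite -innerBl mulrC cauchy_schwarz.
apply: (ncvg_le (C := rnorm y) (hT e Ee)) => n.
suff -> : inner (\sum_(k < n) tens (u k) (v k)) (tens y e) =
    inner (\sum_(k < n) inner e (v k) *: u k) y.
  by rewrite -innerBl mulrC cauchy_schwarz.
rewrite !inner_suml; apply: eq_bigr => k _.
by rewrite tensP innerZl mulrC.
Qed.

End Lambda.

(** * The isometry Phi *)

Section Phi.
Context d (X : measurableType d) (R : realType).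
Variables (mu : {measure set X -> \bar R}) (H W : hilbertType R).
Variables (tens : H -> conjugate H -> W) (D : set X) (pi : X -> H -> H).
Variables (Phi : W -> X -> R[i]).
Hypothesis PhiP : is_Phi mu tens D pi Phi.

Let sq (f : X -> R[i]) (s : X) : \bar R := (complex.Re (`|f s| ^+ 2))%:E.

Lemma sqE f s : sq f s = (rnorm (f s) ^+ 2)%:E.
Proof. by rewrite /sq rnormE -rmorphXn. Qed.

Lemma sq_ge0 f s : (0 <= sq f s)%E.
Proof. by rewrite sqE lee_fin sqr_ge0. Qed.

Lemma measurable_sq f : cmeasurable setT f -> measurable_fun setT (sq f).
Proof.
move=> [mR mI]; apply/measurable_EFinP.
rewrite (_ : (fun s => _) =
    (fun s => complex.Re (f s) ^+ 2 + complex.Im (f s) ^+ 2)); last first.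
  by apply/funext => s; rewrite -add_Re2_Im2.
by apply: measurable_funD; exact: measurable_funX.
Qed.

Lemma L2norm2_Phi w : L2norm2 mu (Phi w) = (rnorm w ^+ 2)%:E.
Proof. by have [_ _ -> _] := PhiP; rewrite rnormE -rmorphXn. Qed.

Lemma PhiB w w' : {ae mu, forall s, Phi (w - w') s = Phi w s - Phi w' s}.
Proof.
have [_ lP _ _] := PhiP; have := lP (-1) w' w.
by apply: filterS => s /(_ I); rewrite scaleN1r mulN1r addrC => ->; rewrite addrC.
Qed.

Lemma Phi_inj w w' : Phi w = Phi w' %[ae mu] -> w = w'.
Proof.
move=> ww'; apply/eqP; rewrite -subr_eq0; apply/eqP/rnorm0_eq0.
suff : rnorm (w - w') ^+ 2 = 0 by move=> /eqP; rewrite expf_eq0/= => /eqP.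
apply: EFin_inj.
rewrite -L2norm2_Phi.
have [/(_ (w - w'))[mP _] _ _ _] := PhiP.
transitivity (\int[mu]_(s in setT) (0 : \bar R))%E; last exact: integral0.
apply: ae_eq_integral => //; first exact: measurable_sq.
apply: filterS2 ww' (PhiB w w') => s /(_ I) ww' h _.
by rewrite h ww' subrr normr0 expr0n.
Qed.

(** Along a sequence tending to 0 in L^2, values below any bound occur at
    arbitrarily late indices, almost everywhere.  Indeed the infimum of
    |f_n|^2 over n >= N has integral 0.  This is weaker than passing to an
    almost everywhere convergent subsequence, but is enough when pointwise
    convergence to some limit is known. *)
Lemma ae_small (f : nat -> X -> R[i]) : (forall n, cmeasurable setT (f n)) ->
  (forall e : R, 0 < e -> exists N, forall n, (N <= n)%N -> (L2norm2 mu (f n) <= e%:E)%E) ->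
  {ae mu, forall s, forall N (e : R), 0 < e -> exists2 n, (N <= n)%N & rnorm (f n s) < e}.
Proof.
move=> mf f0.
have : {ae mu, forall s, forall N, einfs (fun n => sq (f n) s) N = 0%E}.
  apply: ae_foralln => N.
  have m0 s : (0 <= einfs (fun n => sq (f n) s) N)%E.
    by apply: le_ereal_inf_tmp => _ [n /= _ <-]; exact: sq_ge0.
  have me : measurable_fun setT (fun s => einfs (fun n => sq (f n) s) N).
    by apply: measurable_fun_einfs => n; exact: measurable_sq.
  have : (\int[mu]_s `|einfs (fun n => sq (f n) s) N| = 0)%E.
    apply/eqP; rewrite eq_le integral_ge0// andbT.
    apply/lee_addgt0Pr => e /f0[M hM]; rewrite add0e.
    apply: le_trans (hM (maxn N M) (leq_maxr _ _)).
    apply: ge0_le_integral => //.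
    - exact: measurableT_comp.
    - exact: measurable_sq.
    move=> s _; rewrite gee0_abs//; apply: ereal_inf_lbound.
    by exists (maxn N M) => //=; exact: leq_maxl.
  move/(ae_eq_integral_abs mu measurableT me).
  by apply: filterS => s /(_ I).
apply: filterS => s h N e e0.
have := h N; rewrite /einfs/= => hN.
have : (ereal_inf (sdrop (fun n => sq (f n) s) N) < (e ^+ 2)%:E)%E.
  by rewrite hN lte_fin exprn_gt0.
move=> /ereal_inf_lt[_ [n /= Nn <-]]; rewrite sqE lte_fin.
by rewrite ltr_pXn2r ?nnegrE ?rnorm_ge0 ?ltW// => ?; exists n.
Qed.

(** The remainders r_n = w - sum_(k < n) u_k (x) v_k tend to 0, so Phi r_n
    tends to 0 in L^2; almost everywhere, Phi r_n (s) is Phi w (s) minus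
    the n-th partial sum of a Cauchy series.  By [ae_small] some late remainders
    are small at s, and the Cauchy property extends this to all late ones. *)
Lemma Phi_series (u v : nat -> H) (M : R) (w : W) :
  (forall s, D s -> bounded_op (pi s)) ->
  (forall n, \sum_(k < n) rnorm (u k) * rnorm (v k) <= M) ->
  ncvg (fun n => \sum_(k < n) tens (u k) (v k)) w ->
  {ae mu, forall s, D s ->
    ncvg (fun n => \sum_(k < n) inner (pi s (u k)) (v k)) (Phi w s)}.
Proof.
move=> bpi uvM hw.
pose r n := w - \sum_(k < n) tens (u k) (v k).
have Phir n : {ae mu, forall s, D s ->
    Phi (r n) s = Phi w s - \sum_(k < n) inner (pi s (u k)) (v k)}.
  elim: n => [|n IH].
    by apply: aeW => s _; rewrite /r !big_ord0 !subr0.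
  have [_ _ _ Pt] := PhiP.
  have := PhiB (r n) (tens (u n) (v n)).
  apply: filterS3 IH (Pt (u n) (v n)) => s IH Pts hs Ds.
  rewrite /r !big_ord_recr/= !opprD !addrA -/(r n) -IH// -Pts//.
have : {ae mu, forall s, forall N (e : R), 0 < e ->
    exists2 n, (N <= n)%N & rnorm (Phi (r n) s) < e}.
  apply: ae_small => [n|e e0]; first by have [/(_ (r n))[]] := PhiP.
  have [|N hN] := (ncvgP _ _).1 hw (Num.sqrt e); first by rewrite sqrtr_gt0.
  exists N => n Nn; rewrite L2norm2_Phi lee_fin -[leRHS](sqr_sqrtr (ltW e0)).
  by rewrite ler_pXn2r ?nnegrE ?rnorm_ge0 ?sqrtr_ge0// ltW// hN.
apply: filterS2 (ae_foralln Phir) => s hs small Ds.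
have [C [C0 hC]] := bounded_opP (bpi s Ds).
pose c k := rnorm (inner (pi s (u k)) (v k)).
have cM n : \sum_(k < n) c k <= C * M.
  apply: le_trans (ler_wpM2l C0 (uvM n)); rewrite mulr_sumr; apply: ler_sum => k _.
  by rewrite (le_trans (cauchy_schwarz _ _))// mulrA ler_wpM2r ?rnorm_ge0.
apply/ncvgP => e e0; have e2 : 0 < e / 2 by rewrite divr_gt0.
have [N hN] := bounded_sum_tail (fun k => rnorm_ge0 (inner (pi s (u k)) (v k))) cM e2.
exists N => n Nn; have [m nm hm] := small n _ e2.
rewrite hs// in hm; rewrite -(subrKA (\sum_(k < m) inner (pi s (u k)) (v k))).
rewrite (le_lt_trans (rnormD _ _))// [ltRHS]splitr ltrD//.
rewrite (sum_ord_cat (fun k => inner (pi s (u k)) (v k)) nm).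
rewrite (le_lt_trans (rnorm_sum _ _ _))// (le_lt_trans _ (hN m (leq_trans Nn nm)))//.
by rewrite [leRHS](big_cat_nat Nn nm)/= lerDr sumr_ge0// => *; exact: rnorm_ge0.
Qed.

Lemma Phi_inv_Phi w f : f = Phi w %[ae mu] -> Phi_inv mu Phi f = w.
Proof.
move=> fw; rewrite /Phi_inv; case: xgetP => [w' _ fw'|/(_ w)]; last by case.
by apply: Phi_inj; apply: ae_eq_trans fw; exact: ae_eq_sym.
Qed.

Lemma Pi_inv_Lambda (Lambda : W -> H -> H) w : injective Lambda ->
  Pi_inv mu Lambda Phi (Lambda w) = Phi w %[ae mu].
Proof.
move=> Linj; rewrite /Pi_inv; case: xgetP => [f _ [[_ [w' fw']] h]|/(_ (Phi w)) []].
  suff <- : w' = w by [].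
  by apply: Linj; rewrite -h /Pi (Phi_inv_Phi fw').
split; last by rewrite /Pi (@Phi_inv_Phi w)//; exact: ae_eq_refl.
by split; [have [] := PhiP|exists w; exact: ae_eq_refl].
Qed.

End Phi.

(** * The inverse quantization of a trace class operator *)

Theorem corollary3p6 (R : realType) (H : hilbertType R)
    (d : measure_display) (X : measurableType d)
    (mu : {measure set X -> \bar R})
    (D : set X) (pi : X -> H -> H) (pi_SQ : SQ mu D pi)
    (W : hilbertType R) (tens : H -> conjugate H -> W)
    (tensP : hilbert_tensor tens)
    (Lambda : W -> H -> H) (LambdaP : is_Lambda tens Lambda)
    (Phi : W -> X -> R[i]) (PhiP : is_Phi mu tens D pi Phi)
    (T : H -> H) (T_B1 : trace_class T) :
  {ae mu, forall s, D s -> has_trace (T \o pi s) (Pi_inv mu Lambda Phi T s)}.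
Proof.
have [_ bpi _ _] := pi_SQ; have [_ _ tens_inner _] := tensP.
have [E [u [v [M [hE uvM hT]]]]] := trace_class_nuclear T_B1.
have [w Lw hw] := nuclear_Lambda LambdaP tens_inner T_B1.1 hE uvM hT.
have hP := Pi_inv_Lambda PhiP w (Lambda_inj LambdaP); rewrite Lw in hP.
have hS := Phi_series PhiP bpi uvM hw.
apply: filterS2 hP hS => s /(_ I) -> hS Ds.
have [C [C0 hC]] := bounded_opP (bpi s Ds).
apply: (@nuclear_trace _ _ _ u (fun k => adj (pi s) (v k)) (C * M)).
- move=> n; apply: le_trans (ler_wpM2l C0 (uvM n)); rewrite mulr_sumr.
  apply: ler_sum => k _; rewrite mulrCA ler_wpM2l ?rnorm_ge0//.
  exact: adj_le (bpi s Ds) C0 hC _.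
- move=> x y /=; rewrite -Lw (inner_Lambda LambdaP).
  apply: (ncvg_le (C := rnorm (tens y (pi s x))) hw) => n.
  suff -> : \sum_(k < n) inner x (adj (pi s) (v k)) * inner (u k) y =
      inner (\sum_(k < n) tens (u k) (v k)) (tens y (pi s x)).
    by rewrite -innerBl mulrC cauchy_schwarz.
  rewrite inner_suml; apply: eq_bigr => k _.
  by rewrite tens_inner -(adjP (bpi s Ds)) mulrC.
- have := hS Ds; congr ncvg; apply/funext => n; apply: eq_bigr => k _.
  by rewrite (adjP (bpi s Ds)).
Qed.
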